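(* Let $A:\mathcal{D}^*\to\mathbb{C}^m$ be a weak-* continuous linear map which has the RIP on $\mathcal{S}(\Sigma)$ with respect to $\|\cdot\|_{\mathcal H}$ with constant $\gamma\in[0,1)$. Let $\phi:\mathbb{R}^d\to\mathcal{D}^*$ be a parametrization of the cone $\Sigma$ that is weak-* continuous and twice weak-* Gateaux differentiable, with $\Theta=\phi^{-1}(\Sigma)$ open. Suppose that $\|\cdot\|_{\mathcal H}$ satisfies the compatibility assumption (see context). Let $y=Ax_0+e$ with $x_0\in\Sigma$, $e\in\mathbb{C}^m$, let $g(\theta)=\|A\phi(\theta)-y\|_2^2$, and let $\theta^*$ be a global minimizer of $g$ on $\Theta$. Assume that there exists $\beta>0$ such that: 1. the technical assumption (see context) on $\phi$ and on the radius $\beta$ is fulfilled with constants $C_{\phi,\theta^*}$, $M_1$, $M_2$; 2. for any $\theta\in\Lambda_\beta$ there exists $\tilde\theta\in p(\theta,\theta^* )$ such that $$\forall z\in[\theta,\tilde\theta],\qquad \frac{(1-\gamma)\,\|\partial_{\tilde\theta-\theta}\phi(z)\|_{\mathcal H}^2}{\sqrt{1+\gamma}\,\|A\partial^2_{\tilde\theta-\theta}\phi(z)\|_2}\;\ge\; C_{\phi,\theta^*}\,\beta+\frac{1}{\sqrt{1+\gamma}}\|e\|_2,$$ where the quotient is read as $+\infty$ when its denominator vanishes. Then, for every sufficiently small fixed step size (i.e. there is $\tau_0>0$ such that for all $\tau\in(0,\tau_0]$) and every $\theta_0\in\Lambda_\beta$, the gradient descent iterates $\theta_{n+1}=\theta_n-\tau\nabla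 g(\theta_n)$ satisfy $$\|\phi(\theta_n)-x_0\|_{\mathcal H}^2\le\frac{4}{1-\gamma}\|e\|_2^2+O\!\left(\frac1n\right)\qquad(n\to\infty),$$ where the constant in $O(1/n)$ does not depend on $n$.
   Context: Setting. $\mathcal{D}$ is a Banach space, $\mathcal{D}^*$ its dual with the weak-* topology, $\langle\cdot,\cdot\rangle$ the duality product; $A$ has the form $(Ax)_l=\langle x,\alpha_l\rangle$ with $\alpha_l\in\mathcal{D}$, $1\le l\le m$. $\Sigma\subset\mathcal{D}^*$ is a cone ($\lambda x\in\Sigma$ for $x\in\Sigma,\lambda>0$), contained in a Hilbert space $(\mathcal H,\|\cdot\|_{\mathcal H})$ whose vector operations agree with those of $\mathcal{D}^*$ on $\Sigma$. A parametrization of $\Sigma$ is a map $\phi:\mathbb{R}^d\to\mathcal{D}^*$ with $\Sigma\subset\phi(\mathbb{R}^d)$; $\Theta:=\phi^{-1}(\Sigma)$. Weak-* Gateaux differentiability. $\phi$ is weak-* Gateaux differentiable at $\theta$ if there is a linear map $L_\theta:\mathbb{R}^d\to\mathcal{D}^*$ with $(\phi(\theta+hu)-\phi(\theta))/h\to L_\theta u$ weakly-* as $h\to0$, for every $u\in\mathbb{R}^d$; write $\partial_u\phi(\theta)=L_\theta u$. $\phi$ is twice weak-* Gateaux differentiable if it is weak-* Gateaux differentiable and, for every $u$, $\partial_u\phi$ is weak-* Gateaux differentiable; $\partial_u^2\phi=\partial_u\partial_u\phi$. Secants and RIP. $\mathcal{S}(\Sigma)=\Sigma-\Sigma$. The generalized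 secant set $\overline{\mathcal{S}(\Sigma)}$ consists of all elements of $\mathcal{S}(\Sigma)$ and all $\partial_u\phi(\theta)$ with $\phi(\theta)\in\Sigma$, $u\in\mathbb{R}^d$. $A$ has the RIP on $\mathcal{S}(\Sigma)$ with constant $\gamma$ if $(1-\gamma)\|x\|_{\mathcal H}^2\le\|Ax\|_2^2\le(1+\gamma)\|x\|_{\mathcal H}^2$ for all $x\in\mathcal{S}(\Sigma)$. Compatibility assumption. For every $\partial_u\phi(\theta)\in\overline{\mathcal{S}(\Sigma)}$ with $\phi(\theta)\in\Sigma$, $\left\|\frac{\phi(\theta+|h_n|u)-\phi(\theta)}{|h_n|}\right\|_{\mathcal H}$ converges for every real sequence $|h_n|\to0$ to a limit not depending on the sequence; this limit is denoted $\|\partial_u\phi(\theta)\|_{\mathcal H}$. Distance and projection. $d(\theta,\theta^* )=\min\{\|\tilde\theta-\theta\|_2:\tilde\theta\in\Theta,\ \phi(\tilde\theta)=\phi(\theta^* )\}$ for $\theta\in\mathbb{R}^d$; $p(\theta,\theta^* )$ is the set of minimizers $\tilde\theta$; $\Lambda_\beta=\{\theta\in\Theta: d(\theta,\theta^* )<\beta\}$. $[\theta_1,\theta_2]$ is the line segment. Technical assumption on $\phi$ and radius $\beta$ with constants $C_{\phi,\theta^*},M_1,M_2$: (1) every $\theta\in\mathbb{R}^d$ with $d(\theta,\theta^* )<2\beta$ satisfies $\phi(\theta)\in\Sigma$; (2) $C_{\phi,\theta^*}>0$ and $\|\phi(\theta)-\phi(\theta^* )\|_{\mathcal H}\le C_{\phi,\theta^*}d(\theta,\theta^*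 )$ for all $\theta\in\Lambda_{2\beta}$; (3) $M_1=\sup_{\theta\in\phi^{-1}(\phi(\theta^* ))}\sup_{\|u\|_2=1}\|A\partial_u\phi(\theta)\|_2<+\infty$; (4) $M_2=\sup_{\theta\in\Lambda_{2\beta}}\sup_{\|u\|_2=\|v\|_2=1}\|A\partial_v\partial_u\phi(\theta)\|_2<+\infty$. $\nabla g=(\partial g/\partial\theta_i)_{1\le i\le d}$ is the Gateaux gradient. *)

(* Defs.v *)
From HB Require Import structures.
From mathcomp Require Import all_boot all_order all_algebra.
From mathcomp Require Import sesquilinear.
From mathcomp Require Import complex.
From mathcomp Require Import all_classical all_reals all_analysis.

Set Implicit Arguments.
Unset Strict Implicit.
Unset Printing Implicit Defensive.

Import Order.TTheory GRing.Theory Num.Theory.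
Import numFieldNormedType.Exports.

Local Open Scope classical_set_scope.
Local Open Scope complex_scope.
Local Open Scope ring_scope.

(* [dual E] is the topological dual of E, with the weak-* topology: the
   topology induced by pointwise convergence on E. *)
Section Dual.
Context {K : numFieldType} (E : normedModType K).

Definition continuous_functional : {pred E -> K^o} :=
  [pred f | `[< linear f /\ continuous f >] ].

Lemma continuous_functional_submod : submod_closed continuous_functional.
Proof.
split.
  apply/asboolP; split; last by move=> x; exact: cvg_cst.
  by move=> a u v /=; rewrite scaler0 addr0.
move=> a f g /asboolP[lf cf] /asboolP[lg cg]; apply/asboolP; split.
  move=> b u v; rewrite /= !fctE lf lg !scalerDr !scalerA (mulrC a b).
  by rewrite addrACA.
by move=> x; apply: cvgD; [apply: cvgZl_tmp; exact: cf|exact: cg].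
Qed.

HB.instance Definition _ :=
  GRing.isSubmodClosed.Build K (E -> K^o) continuous_functional
    continuous_functional_submod.

Record dual := Dual {
  dual_fun :> E -> K^o;
  _ : dual_fun \in continuous_functional }.

HB.instance Definition _ := [isSub for dual_fun].
HB.instance Definition _ := [Choice of dual by <:].
HB.instance Definition _ := [SubChoice_isSubLmodule of dual by <:].
HB.instance Definition _ := isPointed.Build dual 0.
HB.instance Definition _ := Topological.copy dual
  (initial_topology (dual_fun : dual -> {ptws E -> K^o})).


Lemma weak_star_cvgP (F : set_system dual) (x : dual) : Filter F ->
  F --> x <-> forall a : E, (f : dual) a @[f --> F] --> (x a : K^o).
Proof.
move=> FF.
have ptwsP := @pointwise_cvgP E K^o (dual_fun @ F) x (fmap_filter _ FF).
split=> [Fx a|Fx].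
  have Gx : {ptws, dual_fun @ F --> (x : E -> K^o)}.
    exact: (cvg_comp _ _ Fx (@initial_continuous _ _ _ x)).
  exact: (iffLR ptwsP Gx a).
have Gx : {ptws, dual_fun @ F --> (x : E -> K^o)} by exact/ptwsP.
rewrite /= => B; rewrite nbhsE => -[U [[V oV <-] Vx] UB].
apply: (filterS UB); apply: Gx.
exact: open_nbhs_nbhs.
Qed.

Lemma weak_star_hausdorff : hausdorff_space dual.
Proof.
move=> x y xy; apply: val_inj; apply/funext => a /=.
apply: (@norm_hausdorff K K^o) => A B Ax By.
have evc (z : dual) : (f : dual) a @[f --> z] --> (z a : K^o).
  exact: (iffLR (weak_star_cvgP z (nbhs_filter z)) (@cvg_id _ _) a).
have [z [? ?]] := xy _ _ (evc x _ Ax) (evc y _ By).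
by exists (z a).
Qed.

End Dual.

Section Setting.
Context {R : realType} {D : completeNormedModType R[i]}.

Definition is_cone (Sigma : set (dual D)) : Prop :=
  forall (x : dual D) (lambda : R), Sigma x -> 0 < lambda ->
    Sigma (lambda%:C *: x).

(* The inclusion of Sigma in H is the function iota. It is total, but only its
   values on Sigma and on real combinations of two elements of Sigma (in
   particular on Sigma - Sigma) are constrained: there it is injective on Sigma
   and turns the operations of the dual into those of H. The scalars of H are
   real; a complex Hilbert space is one by restriction of scalars, with the
   same norm. *)
Definition included_in_hilbert {H : completeNormedModType R}
    (Sigma : set (dual D)) (iota : dual D -> H) : Prop :=
  (forall x y, Sigma x -> Sigma y -> iota x = iota y -> x = y) /\
  (forall (x y : dual D) (a b : R), Sigma x -> Sigma y ->
    iota (a%:C *: x + b%:C *: y) = a *: iota x + b *: iota y).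

Definition secant_set (Sigma : set (dual D)) : set (dual D) :=
  [set x - y | x in Sigma & y in Sigma].

Definition normC2 {m} (z : 'rV[R[i]]_m) : R :=
  Num.sqrt (\sum_(l < m) Normc.normc (z ord0 l) ^+ 2).

Definition norm2 {d} (u : 'rV[R]_d) : R :=
  Num.sqrt (\sum_(i < d) u ord0 i ^+ 2).

Definition has_RIP {m} {H : completeNormedModType R}
    (A : dual D -> 'rV[R[i]]_m) (iota : dual D -> H)
    (S : set (dual D)) (gamma : R) : Prop :=
  forall x, S x ->
    (1 - gamma) * `|iota x| ^+ 2 <= normC2 (A x) ^+ 2 /\
    normC2 (A x) ^+ 2 <= (1 + gamma) * `|iota x| ^+ 2.

Definition diff_quot {d} (phi : 'rV[R]_d -> dual D) (u theta : 'rV[R]_d)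
    (h : R) : dual D :=
  (h^-1)%:C *: (phi (theta + h *: u) - phi theta).

Definition weak_star_gateaux {d} (phi : 'rV[R]_d -> dual D)
    (theta : 'rV[R]_d) : Prop :=
  exists L : 'rV[R]_d -> dual D,
    (forall (a : R) u v, L (a *: u + v) = a%:C *: L u + L v) /\
    (forall u, diff_quot phi u theta h @[h --> 0^'] --> L u).

(* The second derivative of phi, first along u and then along v, is
   [wpartial v (wpartial u phi)]. *)
Definition wpartial {d} (u : 'rV[R]_d) (phi : 'rV[R]_d -> dual D)
    (theta : 'rV[R]_d) : dual D :=
  lim (diff_quot phi u theta h @[h --> 0^']).

Definition twice_weak_star_gateaux {d} (phi : 'rV[R]_d -> dual D) : Prop :=
  (forall theta, weak_star_gateaux phi theta) /\
  (forall u theta, weak_star_gateaux (wpartial u phi) theta).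

Definition is_tangent_norm {d} {H : completeNormedModType R}
    (iota : dual D -> H) (phi : 'rV[R]_d -> dual D) (u theta : 'rV[R]_d)
    (l : R) : Prop :=
  forall h : nat -> R, (forall n, h n != 0) ->
    `|h n| @[n --> \oo] --> (0 : R) ->
    `|iota (diff_quot phi u theta `|h n|)| @[n --> \oo] --> l.

Definition compatible_norm {d} {H : completeNormedModType R}
    (Sigma : set (dual D)) (iota : dual D -> H)
    (phi : 'rV[R]_d -> dual D) : Prop :=
  forall theta u, Sigma (phi theta) ->
    exists l, is_tangent_norm iota phi u theta l.

(* The H-norm of [wpartial u phi theta]: the unique l such that
   [is_tangent_norm iota phi u theta l], when it exists. *)
Definition tangent_norm {d} {H : completeNormedModType R}
    (iota : dual D -> H) (phi : 'rV[R]_d -> dual D)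
    (u theta : 'rV[R]_d) : R :=
  get (is_tangent_norm iota phi u theta).

Definition fiber {d} (Sigma : set (dual D)) (phi : 'rV[R]_d -> dual D)
    (thetastar : 'rV[R]_d) : set 'rV[R]_d :=
  [set t | Sigma (phi t) /\ phi t = phi thetastar].

(* The infimum is attained when phi is weak-* continuous and thetastar is in
   Theta. *)
Definition fiber_dist {d} (Sigma : set (dual D)) (phi : 'rV[R]_d -> dual D)
    (theta thetastar : 'rV[R]_d) : R :=
  inf [set norm2 (t - theta) | t in fiber Sigma phi thetastar].

Definition fiber_proj {d} (Sigma : set (dual D)) (phi : 'rV[R]_d -> dual D)
    (theta thetastar : 'rV[R]_d) : set 'rV[R]_d :=
  [set t | fiber Sigma phi thetastar t /\
           norm2 (t - theta) = fiber_dist Sigma phi theta thetastar].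

Definition basin {d} (Sigma : set (dual D)) (phi : 'rV[R]_d -> dual D)
    (thetastar : 'rV[R]_d) (beta : R) : set 'rV[R]_d :=
  [set theta | Sigma (phi theta) /\
               fiber_dist Sigma phi theta thetastar < beta].

Definition segment {d} (theta1 theta2 : 'rV[R]_d) : set 'rV[R]_d :=
  [set (1 - t) *: theta1 + t *: theta2 | t in `[0, 1]].

Record technical_assumption {m d} {H : completeNormedModType R}
    (Sigma : set (dual D)) (iota : dual D -> H)
    (A : dual D -> 'rV[R[i]]_m) (phi : 'rV[R]_d -> dual D)
    (thetastar : 'rV[R]_d) (beta C : R) (M1 M2 : \bar R) : Prop := {
  ta_neighborhood : forall theta,
    fiber_dist Sigma phi theta thetastar < 2 * beta -> Sigma (phi theta);
  ta_C_gt0 : 0 < C;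
  ta_lipschitz : forall theta, basin Sigma phi thetastar (2 * beta) theta ->
    `|iota (phi theta - phi thetastar)| <=
      C * fiber_dist Sigma phi theta thetastar;
  ta_M1 : M1 = ereal_sup [set r | exists theta u,
    [/\ phi theta = phi thetastar, norm2 u = 1 &
        r = (normC2 (A (wpartial u phi theta)))%:E]];
  ta_M1_fin : (M1 < +oo)%E;
  ta_M2 : M2 = ereal_sup [set r | exists theta u v,
    [/\ basin Sigma phi thetastar (2 * beta) theta, norm2 u = 1, norm2 v = 1 &
        r = (normC2 (A (wpartial v (wpartial u phi) theta)))%:E]];
  ta_M2_fin : (M2 < +oo)%E }.

(* A quotient of nonnegative reals, with a / 0 = +oo. *)
Definition equot (a b : R) : \bar R :=
  if b == 0 then +oo%E else (a / b)%:E.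

Definition grad {d} (g : 'rV[R]_d -> R) (theta : 'rV[R]_d) : 'rV[R]_d :=
  \row_(i < d) 'D_(delta_mx ord0 i) g theta.

Definition grad_descent {d} (g : 'rV[R]_d -> R) (tau : R)
    (theta0 : 'rV[R]_d) (n : nat) : 'rV[R]_d :=
  iter n (fun theta => theta - tau *: grad g theta) theta0.

End Setting.

(* Main.v *)
Require Import Defs.
From HB Require Import structures.
From mathcomp Require Import all_boot all_order all_algebra.
From mathcomp Require Import sesquilinear.
From mathcomp Require Import complex.
From mathcomp Require Import all_classical all_reals all_analysis.
From mathcomp Require Import ring lra.

Set Implicit Arguments.
Unset Strict Implicit.
Unset Printing Implicit Defensive.

Import Order.TTheory GRing.Theory Num.Theory.
Import numFieldNormedType.Exports.

Local Open Scope classical_set_scope.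
Local Open Scope complex_scope.
Local Open Scope ring_scope.

(* Let T be the fibre of phi over phi(thetastar), dist the distance to T and gstar
   the minimum of g. Along the segment from theta to its projection t on T, the
   second derivative of g is 2 (|A d phi|^2 + Re <A d^2 phi, A phi - y>), which
   the RIP (passed to the limit on tangent vectors) and the basin hypothesis
   make nonnegative. Hence <grad g(theta), theta - t> >= g(theta) - gstar, although
   g is not convex. The constants M1 and M2 bound the first two derivatives of g
   on dist < 2 beta, which gives the descent inequality
   g(theta - tau grad g) <= g(theta) - tau/2 |grad g|^2, and then
   dist(theta_{n+1})^2 <= dist(theta_n)^2 - tau (g(theta_n) - gstar): the iterates
   stay in the basin, and summing, with g(theta_n) decreasing, gives
   g(theta_n) - gstar = O(1/n). The RIP turns this into the bound on phi(theta_n). *)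

(** * Euclidean norm and a second-order mean value theorem *)

Section Euclidean.
Context {R : realType} {d : nat}.
Implicit Types (u v w : 'rV[R]_d) (a : R).

Definition dotr u v : R := \sum_(i < d) u ord0 i * v ord0 i.

Lemma dotrC u v : dotr u v = dotr v u.
Proof. by apply: eq_bigr => i _; rewrite mulrC. Qed.

Lemma dotrDl u v w : dotr (u + v) w = dotr u w + dotr v w.
Proof. by rewrite -big_split; apply: eq_bigr => i _; rewrite mxE mulrDl. Qed.

Lemma dotrZl a u v : dotr (a *: u) v = a * dotr u v.
Proof. by rewrite mulr_sumr; apply: eq_bigr => i _; rewrite mxE mulrA. Qed.

Lemma dotrDr u v w : dotr u (v + w) = dotr u v + dotr u w.
Proof. by rewrite !(dotrC u) dotrDl. Qed.

Lemma dotrZr a u v : dotr u (a *: v) = a * dotr u v.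
Proof. by rewrite !(dotrC u) dotrZl. Qed.

Lemma norm2_ge0 u : 0 <= norm2 u.
Proof. exact: sqrtr_ge0. Qed.

Lemma sqr_norm2 u : norm2 u ^+ 2 = dotr u u.
Proof.
by rewrite sqr_sqrtr ?sumr_ge0// => i _; rewrite sqr_ge0.
Qed.

Lemma norm2_eq0 u : norm2 u = 0 -> u = 0.
Proof.
move=> u0; have : dotr u u = 0 by rewrite -sqr_norm2 u0 expr0n.
move=> /eqP; rewrite psumr_eq0 => [/allP uu|i _]; last by rewrite -expr2 sqr_ge0.
apply/rowP => i; rewrite mxE.
by have := uu i (mem_index_enum i); rewrite mulf_eq0 orbb => /eqP.
Qed.

Lemma norm2Z a u : norm2 (a *: u) = `|a| * norm2 u.
Proof.
apply/eqP; rewrite -(eqrXn2 (n := 2))// ?mulr_ge0 ?norm2_ge0//.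
by rewrite exprMn !sqr_norm2 dotrZl dotrZr real_normK ?num_real// mulrA expr2.
Qed.

Lemma norm20 : norm2 (0 : 'rV[R]_d) = 0.
Proof. by rewrite -(scale0r 0) norm2Z normr0 mul0r. Qed.

Lemma norm2N u : norm2 (- u) = norm2 u.
Proof. by rewrite -scaleN1r norm2Z normrN1 mul1r. Qed.

Lemma sqr_norm2D u v :
  norm2 (u + v) ^+ 2 = norm2 u ^+ 2 + 2 * dotr u v + norm2 v ^+ 2.
Proof.
by rewrite !sqr_norm2 !dotrDl !dotrDr (dotrC v u); ring.
Qed.

(** Cauchy-Schwarz: expand [|v|^2 u - <u,v> v] in squared norm, which is nonnegative, and cancel
    [|v|^2]. *)
Lemma dotr_le u v : dotr u v <= norm2 u * norm2 v.
Proof.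
have [v0|vn0] := eqVneq (norm2 v) 0.
  rewrite v0 mulr0 (norm2_eq0 v0) /dotr big1// => i _.
  by rewrite mxE mulr0.
have v_gt0 : 0 < norm2 v by rewrite lt_neqAle eq_sym vn0 norm2_ge0.
have [un|up] := ltP (dotr u v) 0.
  by apply: (le_trans (ltW un)); rewrite mulr_ge0 ?norm2_ge0.
rewrite -ler_sqr ?nnegrE ?mulr_ge0 ?norm2_ge0//.
have := sqr_ge0 (norm2 (norm2 v ^+ 2 *: u + (- dotr u v) *: v)).
rewrite sqr_norm2D dotrZl dotrZr !norm2Z !exprMn !real_normK ?num_real//.
have v2_gt0 : 0 < norm2 v ^+ 2 by rewrite exprn_gt0.
move=> h; rewrite -(ler_pM2l v2_gt0) -subr_ge0.
by apply: le_trans h _; rewrite le_eqVlt; apply/orP; left; apply/eqP; ring.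
Qed.

Lemma normr_dotr_le u v : `|dotr u v| <= norm2 u * norm2 v.
Proof.
rewrite ler_norml dotr_le andbT lerNl.
by rewrite -mulN1r -dotrZl scaleN1r -(norm2N u) dotr_le.
Qed.

Lemma ler_norm2D u v : norm2 (u + v) <= norm2 u + norm2 v.
Proof.
rewrite -ler_sqr ?nnegrE ?addr_ge0 ?norm2_ge0//.
by rewrite sqr_norm2D; have := dotr_le u v; lra.
Qed.

Lemma norm2_normalize u : 0 < norm2 u ->
  norm2 ((norm2 u)^-1 *: u) = 1.
Proof.
by move=> u0; rewrite norm2Z ger0_norm ?invr_ge0 ?norm2_ge0// mulVf ?lt0r_neq0.
Qed.

End Euclidean.

(** Two mean value theorems, for [f] on [[0, 1]] and then for [f'] on [[0, s]]. The remainder has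
    weight [s] in place of Taylor's 1/2, and [f''] may be discontinuous, as Gateaux derivatives can
    be. *)
Lemma second_order_mvt (R : realType) (f f' f'' : R -> R) :
  (forall t : R, is_derive t 1 f (f' t)) -> (forall t : R, is_derive t 1 f' (f'' t)) ->
  exists s t, [/\ 0 <= s <= 1, 0 <= t <= 1 & f 1 = f 0 + f' 0 + s * f'' t].
Proof.
move=> ff' f'f''.
have cont (h h' : R -> R) : (forall t : R, is_derive t 1 h (h' t)) ->
    forall a b : R, {within `[a, b], continuous h}.
  move=> hh' a b; apply: derivable_within_continuous => t _.
  by have [] := hh' t.
have [s /andP[s0 s1] fE] : exists2 s, 0 < s < 1 & f 1 - f 0 = f' s * (1 - 0).
  have [s] := MVT ltr01 (fun t _ => ff' t) (cont _ _ ff' _ _).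
  by rewrite in_itv /= => ? ?; exists s.
have [t /andP[t0 ts] f'E] : exists2 t, 0 < t < s & f' s - f' 0 = f'' t * (s - 0).
  have [t] := MVT s0 (fun t _ => f'f'' t) (cont _ _ f'f'' _ _).
  by rewrite in_itv /= => ? ?; exists t.
exists s, t; split; [lra|lra|].
by rewrite subr0 mulr1 in fE; rewrite subr0 in f'E; lra.
Qed.

(** * Gradient descent towards a set of minimizers *)

Section SetDistance.
Context {R : realType} {d : nat} (T : set 'rV[R]_d).
Implicit Types t u v w : 'rV[R]_d.

(** For [T] the fibre this is convertible to [fiber_dist]. *)
Definition set_dist v : R := inf [set norm2 (t - v) | t in T].

Lemma set_dist_le t v : T t -> set_dist v <= norm2 (t - v).
Proof.
move=> Tt; apply: ge_inf; last by exists t.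
by exists 0 => _ [w _ <-]; exact: norm2_ge0.
Qed.

Lemma set_dist_ge0 v : 0 <= set_dist v.
Proof.
(* The infimum of the empty set is 0 by default. *)
have [T0|/set0P[t Tt]] := eqVneq T set0.
  by rewrite /set_dist T0 image_set0 inf0.
apply: lb_le_inf; first by exists (norm2 (t - v)), t.
by move=> _ [w _ <-]; exact: norm2_ge0.
Qed.

Lemma set_dist_lt v r : T !=set0 -> set_dist v < r ->
  exists2 t, T t & norm2 (t - v) < r.
Proof.
move=> [t0 Tt0] vr; have [|_ [t Tt <-] tr] := inf_lt _ vr; last by exists t.
by exists (norm2 (t0 - v)), t0.
Qed.

Lemma set_distD v w : T !=set0 -> set_dist (v + w) <= set_dist v + norm2 w.
Proof.
move=> T0; apply/ler_addgt0Pr => eps eps0.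
have : set_dist v < set_dist v + eps by rewrite ltrDl.
move=> /(set_dist_lt T0)[t Tt tv].
apply: (le_trans (set_dist_le _ Tt)).
have -> : t - (v + w) = (t - v) + (- w) by rewrite opprD addrA.
by apply: (le_trans (ler_norm2D _ _)); rewrite norm2N; lra.
Qed.

End SetDistance.

Section GradientDescent.
Context {R : realType} {d : nat}.
Variables (g : 'rV[R]_d -> R) (g1 g2 : 'rV[R]_d -> 'rV[R]_d -> R).
Hypothesis g1_lin : forall v (a : R) u w, g1 (a *: u + w) v = a * g1 u v + g1 w v.
Hypothesis g1_derive : forall u v (s : R),
  is_derive s 1 (fun s : R => g (v + s *: u)) (g1 u (v + s *: u)).
Hypothesis g2_derive : forall u v (s : R),
  is_derive s 1 (fun s : R => g1 u (v + s *: u)) (g2 u (v + s *: u)).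

(** [grad] only collects derivatives along coordinate vectors; linearity of [g1] in the direction
    recovers all the others. *)
Lemma gradE u v : g1 u v = dotr (grad g v) u.
Proof.
have g1_sum (I : Type) (r : seq I) (F : I -> 'rV[R]_d) (a : I -> R) :
    g1 (\sum_(i <- r) a i *: F i) v = \sum_(i <- r) a i * g1 (F i) v.
  elim: r => [|i r IHr]; last by rewrite !big_cons g1_lin IHr.
  by rewrite !big_nil; have := g1_lin v 1 0 0; rewrite scale1r addr0; lra.
have g1_grad i : grad g v ord0 i = g1 (delta_mx ord0 i) v.
  rewrite /grad mxE; have [_] := g1_derive (delta_mx ord0 i) v 0.
  rewrite scale0r addr0 => <-; rewrite /derive.
  apply: (congr1 (fun F : R -> R => lim (F @ 0^'))); apply/funext => h /=.
  by rewrite scale0r !addr0 [_%:A]mulr1 (addrC v).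
rewrite {1}(row_sum_delta u) g1_sum.
by apply: eq_bigr => i _; rewrite g1_grad mulrC.
Qed.

Lemma second_order_line u v :
  exists s t : R, [/\ 0 <= s <= 1, 0 <= t <= 1 &
    g (v + u) = g v + g1 u v + s * g2 u (v + t *: u)].
Proof.
have [s [t [s01 t01]]] := second_order_mvt (g1_derive u v) (g2_derive u v).
by rewrite !scale1r scale0r !addr0 => ->; exists s, t.
Qed.

Variables (T : set 'rV[R]_d) (beta G L gstar : R).
Hypotheses (T_nonempty : T !=set0) (beta_gt0 : 0 < beta).
Hypotheses (G_gt0 : 0 < G) (L_gt0 : 0 < L).
Hypothesis g1_bound : forall u v, set_dist T v < 2 * beta -> g1 u v <= G * norm2 u.
Hypothesis g2_bound : forall u v, set_dist T v < 2 * beta ->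
  g2 u v <= L * norm2 u ^+ 2.
Hypothesis g_min : forall v, set_dist T v < 2 * beta -> gstar <= g v.
Hypothesis g_T : forall v, T v -> g v = gstar.
Hypothesis g_convex : forall v, set_dist T v < beta ->
  exists t, [/\ T t, norm2 (t - v) = set_dist T v &
    forall s : R, 0 <= s <= 1 -> 0 <= g2 (t - v) (v + s *: (t - v))].

(* [beta / G] keeps a step inside [dist < 2 beta]; [L^-1 / 2] gives descent. *)
Let tau1 := Num.min (beta / G) (L^-1 / 2).

Let tau1_gt0 : 0 < tau1.
Proof. by rewrite lt_min !divr_gt0 ?invr_gt0. Qed.

(** Test the bound on [g1] in the direction of the gradient itself and divide by its norm. *)
Lemma norm2_grad_le v : set_dist T v < 2 * beta -> norm2 (grad g v) <= G.
Proof.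
move=> vb; have := g1_bound (grad g v) vb; rewrite gradE -sqr_norm2 expr2.
have := norm2_ge0 (grad g v); rewrite le_eqVlt => /predU1P[<-|n0].
  by move=> _; exact: ltW.
by rewrite ler_pM2r.
Qed.

(** The step has length at most [beta]. A zero step is allowed so that intermediate points of a step
    are covered too. *)
Lemma grad_step_dist v tau : 0 <= tau <= tau1 -> set_dist T v < beta ->
  set_dist T (v + tau *: - grad g v) < 2 * beta.
Proof.
move=> /andP[tau0 tau_le] vb; apply: le_lt_trans (set_distD _ _ T_nonempty) _.
rewrite norm2Z norm2N ger0_norm//.
have vb2 : set_dist T v < 2 * beta by have b0 := beta_gt0; lra.
have : tau * norm2 (grad g v) <= beta.
  rewrite -(divfK (lt0r_neq0 G_gt0) beta).
  rewrite ler_pM ?norm2_ge0 ?norm2_grad_le//.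
  by apply: (le_trans tau_le); rewrite ge_min lexx.
lra.
Qed.

(** In the second-order expansion along the step, the linear term is [- tau |grad g|^2] and the
    remainder is at most [L tau^2 |grad g|^2], which [L tau <= 1/2] reduces to half the linear
    gain. *)
Lemma grad_step_descent v tau : 0 < tau <= tau1 -> set_dist T v < beta ->
  g (v + tau *: - grad g v) <= g v - tau / 2 * norm2 (grad g v) ^+ 2.
Proof.
move=> /andP[tau0 tau_le] vb.
have [s [t [/andP[s0 s1] /andP[t0 t1] ->]]] :=
  second_order_line (tau *: - grad g v) v.
have zb : set_dist T (v + t *: (tau *: - grad g v)) < 2 * beta.
  rewrite scalerA; apply: grad_step_dist => //.
  rewrite mulr_ge0 ?(ltW tau0)//=; apply: le_trans tau_le.
  by rewrite -[leRHS]mul1r ler_pM2r.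
have := g2_bound (tau *: - grad g v) zb.
rewrite gradE dotrZr -scaleN1r dotrZr -sqr_norm2 !norm2Z normrN1 mul1r gtr0_norm//.
set a := norm2 _ ; set b := g2 _ _ => bL.
have Ltau : L * tau <= 2^-1.
  have : tau <= L^-1 / 2 by apply: (le_trans tau_le); rewrite ge_min lexx orbT.
  by rewrite -(ler_pM2l L_gt0) mulrA divff ?lt0r_neq0// mul1r.
(* [b] may be negative, so it is replaced by its upper bound before [s] is replaced by 1. *)
have : s * b <= tau * 2^-1 * a ^+ 2.
  apply: (@le_trans _ _ (s * (L * (tau * a) ^+ 2))); first by rewrite ler_wpM2l.
  apply: (@le_trans _ _ (L * (tau * a) ^+ 2)).
    by rewrite -[leRHS]mul1r ler_wpM2r// mulr_ge0 ?sqr_ge0// ltW.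
  have -> : L * (tau * a) ^+ 2 = L * tau * (tau * a ^+ 2) by ring.
  have -> : tau * 2^-1 * a ^+ 2 = 2^-1 * (tau * a ^+ 2) by ring.
  by rewrite ler_wpM2r// mulr_ge0 ?sqr_ge0// ltW.
lra.
Qed.

(** Expand the squared distance from the new point to the projection [t] of [v]. The cross term
    gains [2 tau (g v - gstar)] by convexity along the segment; the term in [tau^2] loses at most
    half of it, because [tau <= tau1 / 2]. *)
Lemma grad_step_contract v tau : 0 < tau <= tau1 / 2 -> set_dist T v < beta ->
  set_dist T (v - tau *: grad g v) ^+ 2 <=
    set_dist T v ^+ 2 - tau * (g v - gstar).
Proof.
move=> /andP[tau0 tau_le] vb.
have [t [Tt tv conv]] := g_convex vb.
have [s [r [/andP[s0 s1] r01 gt]]] := second_order_line (t - v) v.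
have g1_le : g1 (t - v) v <= gstar - g v.
  move: gt; rewrite addrC subrK (g_T Tt) => ->.
  have := mulr_ge0 s0 (conv r r01); lra.
(* A step of size tau1 cannot decrease g below gstar. *)
have grad2 : norm2 (grad g v) ^+ 2 <= 2 / tau1 * (g v - gstar).
  have tau11 : 0 < tau1 <= tau1 by rewrite tau1_gt0 lexx.
  have tau12 : 0 <= tau1 <= tau1 by rewrite ltW// lexx.
  have := g_min (grad_step_dist tau12 vb); have := grad_step_descent tau11 vb.
  set a := norm2 _ ^+ 2 => h1 h2.
  have h3 : tau1 * a <= 2 * (g v - gstar) by lra.
  by rewrite mulrAC ler_pdivlMr// mulrC.
have := set_dist_le (v - tau *: grad g v) Tt.
have -> : t - (v - tau *: grad g v) = (t - v) + tau *: grad g v.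
  by rewrite opprD opprK addrA.
rewrite -ler_sqr ?nnegrE ?norm2_ge0 ?set_dist_ge0// sqr_norm2D tv.
rewrite dotrZr dotrC -gradE norm2Z gtr0_norm// exprMn => h.
apply: (le_trans h).
have : tau * g1 (t - v) v <= tau * (gstar - g v) by rewrite ler_pM2l.
have : tau ^+ 2 * norm2 (grad g v) ^+ 2 <= tau * (g v - gstar).
  apply: (@le_trans _ _ (tau ^+ 2 * (2 / tau1 * (g v - gstar)))).
    by rewrite ler_wpM2l ?sqr_ge0.
  have -> : tau ^+ 2 * (2 / tau1 * (g v - gstar)) =
      tau / (tau1 / 2) * (tau * (g v - gstar)).
    by field; rewrite lt0r_neq0.
  rewrite -[leRHS]mul1r ler_wpM2r//.
    by rewrite mulr_ge0 ?(ltW tau0)// subr_ge0 g_min//; have := beta_gt0; lra.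
  by rewrite ler_pdivrMr ?divr_gt0// mul1r.
lra.
Qed.

Lemma grad_descent_rate : exists2 tau0 : R, 0 < tau0 &
  forall tau, 0 < tau <= tau0 -> forall v, set_dist T v < beta ->
    (forall n, set_dist T (grad_descent g tau v n) < beta) /\
    exists K : R, forall n, (0 < n)%N ->
      g (grad_descent g tau v n) - gstar <= K / n%:R.
Proof.
exists (tau1 / 2); first by rewrite divr_gt0.
move=> tau tau12 v vb; set x := grad_descent g tau v.
have /andP[tau0 tau_le] := tau12.
have xS n : x n.+1 = x n - tau *: grad g (x n) by [].
have decr n : set_dist T (x n) < beta -> gstar <= g (x n) /\ g (x n.+1) <= g (x n).
  move=> xb; split; first by apply: g_min; have := xb; have := beta_gt0; lra.
  have tau1' : 0 < tau <= tau1.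
    by rewrite tau0/= (le_trans tau_le)// ler_pdivrMr// ler_peMr ?ltW// ltr1n.
  have := grad_step_descent tau1' xb; rewrite scalerN -xS.
  have := mulr_ge0 (ltW tau0) (sqr_ge0 (norm2 (grad g (x n)))); lra.
have xb n : set_dist T (x n) < beta.
  elim: n => // n IHn; have := grad_step_contract tau12 IHn; rewrite -xS => h.
  apply: le_lt_trans (IHn); rewrite -ler_sqr ?nnegrE ?set_dist_ge0//.
  apply: (le_trans h); rewrite lerBlDr lerDl mulr_ge0 ?(ltW tau0)// subr_ge0.
  by have [] := decr n IHn.
split=> //; exists (set_dist T v ^+ 2 / tau) => n n0.
(* Telescoped contraction: since [g] decreases along the iterates, the last gap bounds each earlier
   one from below. *)
have tele k : tau * k%:R * (g (x k) - gstar) <= set_dist T v ^+ 2 - set_dist T (x k) ^+ 2.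
  elim: k => [|k IHk]; first by rewrite mulr0 mul0r subrr.
  have := grad_step_contract tau12 (xb k); rewrite -xS => h.
  have [gk gSk] := decr k (xb k).
  have : tau * k.+1%:R * (g (x k.+1) - gstar) <= tau * k.+1%:R * (g (x k) - gstar).
    by rewrite ler_wpM2l ?mulr_ge0 ?(ltW tau0)// lerD2r.
  move: IHk h; rewrite -natr1; set a := g (x k); set b := g _; nra.
rewrite -mulrA -invfM ler_pdivlMr ?mulr_gt0 ?ltr0n// mulrC.
apply: (le_trans (tele n)); have := sqr_ge0 (set_dist T (x n)); lra.
Qed.

End GradientDescent.

(** * Least squares *)

(** The hypotheses are coordinatewise, the form in which weak-* differentiability yields derivatives
    of measurements. *)
Lemma is_derive_dotr (R : realType) (k : nat) (f h : R -> 'rV[R]_k)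
    (f' h' : 'rV[R]_k) (t : R) :
  (forall i, is_derive t 1 (fun s => f s ord0 i) (f' ord0 i)) ->
  (forall i, is_derive t 1 (fun s => h s ord0 i) (h' ord0 i)) ->
  is_derive t 1 (fun s => dotr (f s) (h s)) (dotr (f t) h' + dotr f' (h t)).
Proof.
move=> ff hh.
have -> : (fun s => dotr (f s) (h s)) =
    \sum_(i < k) ((fun s => f s ord0 i) * (fun s => h s ord0 i)).
  by apply/funext => s; rewrite fct_sumE.
rewrite -big_split.
have -> : \sum_(i < k) (f t ord0 i * h' ord0 i + f' ord0 i * h t ord0 i) =
    \sum_(i < k) (f t ord0 i *: h' ord0 i + h t ord0 i *: f' ord0 i).
  by apply: eq_bigr => i _; rewrite [f' _ _ * _]mulrC.
by apply: is_derive_sum => i; apply: is_deriveM.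
Qed.

Section LeastSquares.
Context {R : realType} {d k : nat}.
(* [J u v] is the derivative of F at v along u; [Hs w u] that of [J u] along w. *)
Variables (F : 'rV[R]_d -> 'rV[R]_k) (J : 'rV[R]_d -> 'rV[R]_d -> 'rV[R]_k).
Variable Hs : 'rV[R]_d -> 'rV[R]_d -> 'rV[R]_d -> 'rV[R]_k.
Hypothesis J_lin : forall v (a : R) u w, J (a *: u + w) v = a *: J u v + J w v.
Hypothesis F_derive : forall u v i (s : R), is_derive s 1
  (fun s : R => F (v + s *: u) ord0 i) (J u (v + s *: u) ord0 i).
Hypothesis J_derive : forall w u v i (s : R), is_derive s 1
  (fun s : R => J u (v + s *: w) ord0 i) (Hs w u (v + s *: w) ord0 i).
Hypothesis Hs_lin : forall v u (a : R) w w',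
  Hs (a *: w + w') u v = a *: Hs w u v + Hs w' u v.

Let g v := norm2 (F v) ^+ 2.
Let g1 u v := 2 * dotr (J u v) (F v).
Let g2 u v := 2 * (norm2 (J u v) ^+ 2 + dotr (Hs u u v) (F v)).

Lemma sqr_norm2_derive u v (s : R) :
  is_derive s 1 (fun s : R => g (v + s *: u)) (g1 u (v + s *: u)).
Proof.
under eq_fun do rewrite /g sqr_norm2.
have -> : g1 u (v + s *: u) = dotr (F (v + s *: u)) (J u (v + s *: u)) +
    dotr (J u (v + s *: u)) (F (v + s *: u)).
  by rewrite /g1 (dotrC (F _)); ring.
by apply: (@is_derive_dotr _ _ (fun s => F (v + s *: u)) (fun s => F (v + s *: u))).
Qed.

Lemma sqr_norm2_derive2 u v (s : R) :
  is_derive s 1 (fun s : R => g1 u (v + s *: u)) (g2 u (v + s *: u)).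
Proof.
rewrite /g2 sqr_norm2.
have -> : (fun s : R => g1 u (v + s *: u)) =
  2 \*: (fun s : R => dotr (J u (v + s *: u)) (F (v + s *: u))) by [].
apply: is_deriveZ.
by apply: (@is_derive_dotr _ _ (fun s => J u (v + s *: u)) (fun s => F (v + s *: u))).
Qed.

(** Homogeneity in the inner direction comes from differentiating that of [J]. It extends the bound
    [M2] beyond unit directions. *)
Lemma second_derivativeZ w u v (a : R) : Hs w (a *: u) v = a *: Hs w u v.
Proof.
have JZ z := GRing.scalable_linear (J_lin z).
apply/rowP => i.
have [_] := J_derive w (a *: u) v i 0.
have -> : (fun s : R => J (a *: u) (v + s *: w) ord0 i) =
   a \*: (fun s : R => J u (v + s *: w) ord0 i).
  by apply/funext => s; rewrite JZ mxE.
have [_] := is_deriveZ a (J_derive w u v i 0).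
by rewrite scale0r addr0 => -> <-; rewrite mxE.
Qed.

Variables (T : set 'rV[R]_d) (beta M1 M2 B : R).
Hypotheses (T_nonempty : T !=set0) (beta_gt0 : 0 < beta).
Hypotheses (M1_ge0 : 0 <= M1) (M2_ge0 : 0 <= M2).
Hypothesis J_T : forall v u, T v -> norm2 u = 1 -> norm2 (J u v) <= M1.
Hypothesis Hs_bound : forall v u w, set_dist T v < 2 * beta ->
  norm2 u = 1 -> norm2 w = 1 -> norm2 (Hs w u v) <= M2.
Hypothesis F_bound : forall v, set_dist T v < 2 * beta -> norm2 (F v) <= B.

Lemma homogeneous_bound (f : 'rV[R]_d -> 'rV[R]_k) M :
  (forall (a : R) u, f (a *: u) = a *: f u) ->
  (forall u, norm2 u = 1 -> norm2 (f u) <= M) ->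
  forall u, norm2 (f u) <= M * norm2 u.
Proof.
move=> fZ fM u; have := norm2_ge0 u; rewrite le_eqVlt => /predU1P[u0|u0].
  have -> : u = 0 by exact/norm2_eq0.
  by rewrite -{1}(scale0r 0) fZ scale0r !norm20 mulr0.
have := fM _ (norm2_normalize u0).
by rewrite fZ norm2Z ger0_norm ?invr_ge0 ?norm2_ge0// ler_pdivrMl// mulrC.
Qed.

Lemma norm2_second_derivative_le v u w : set_dist T v < 2 * beta ->
  norm2 (Hs w u v) <= M2 * norm2 u * norm2 w.
Proof.
move=> vb.
apply: (@homogeneous_bound (fun w => Hs w u v)) => [|{}w w1].
  exact: GRing.scalable_linear (Hs_lin v u).
apply: (@homogeneous_bound (fun u => Hs w u v)) => [a {}u|{}u u1].
  exact: second_derivativeZ.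
exact: Hs_bound.
Qed.

(** [M1] controls [J] on [T] only, so [J u v] is compared with [J u t] at a point [t] of [T] closer
    than [2 * beta]. Pairing with the increment [w] itself reduces the vector-valued mean value
    inequality to a scalar one. *)
Lemma norm2_jacobian_le v u : set_dist T v < 2 * beta ->
  norm2 (J u v) <= (M1 + 2 * beta * M2) * norm2 u.
Proof.
move=> vb.
have [t Tt tv] := set_dist_lt T_nonempty vb.
pose w := J u v - J u t.
have dw (s : R) : is_derive s 1 (fun s => dotr (J u (t + s *: (v - t))) w)
    (dotr (Hs (v - t) u (t + s *: (v - t))) w).
  have := @is_derive_dotr _ _ (fun s => J u (t + s *: (v - t))) (fun=> w)
    (Hs (v - t) u (t + s *: (v - t))) 0 s (fun i => J_derive _ _ _ _ _).
  (* The product rule term containing the derivative of the constant [w] vanishes. *)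
  rewrite dotrC -(scale0r 0) dotrZl mul0r add0r; apply=> i.
  by rewrite scale0r [X in is_derive _ _ _ X]mxE; exact: is_derive_cst.
have [|s] := MVT_segment ler01 (fun s _ => dw s).
  by apply: derivable_within_continuous => s _; have [] := dw s.
rewrite in_itv /= scale1r subrKC scale0r addr0 subr0 mulr1 => /andP[s0 s1].
have -> : dotr (J u v) w - dotr (J u t) w = norm2 w ^+ 2.
  by rewrite sqr_norm2 {3}/w dotrDl -(scaleN1r (J u t)) dotrZl mulN1r.
move=> wE.
have tz : norm2 (v - t) < 2 * beta by rewrite -norm2N opprB.
have zb : set_dist T (t + s *: (v - t)) < 2 * beta.
  apply: le_lt_trans tz; apply: (le_trans (set_dist_le _ Tt)).
  rewrite opprD addNKr norm2N norm2Z ger0_norm//.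
  by rewrite -[leRHS]mul1r ler_wpM2r ?norm2_ge0.
have w_le : norm2 w <= 2 * beta * M2 * norm2 u.
  have [w0|w0] := leP (norm2 w) 0.
    by apply: (le_trans w0); rewrite !mulr_ge0 ?norm2_ge0 ?(ltW beta_gt0).
  rewrite -(ler_pM2r w0) -expr2 wE.
  apply: (le_trans (dotr_le _ _)); rewrite ler_wpM2r ?norm2_ge0//.
  apply: (le_trans (norm2_second_derivative_le _ _ zb)).
  rewrite -mulrA [2 * beta * M2]mulrC -mulrA ler_wpM2l//.
  by rewrite mulrC ler_wpM2r ?norm2_ge0 ?ltW.
have -> : J u v = J u t + w by rewrite /w addrC subrK.
apply: (le_trans (ler_norm2D _ _)); rewrite mulrDl lerD//.
apply: (@homogeneous_bound (fun u => J u t)) => [|u'].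
  exact: GRing.scalable_linear (J_lin t).
by move=> ?; exact: J_T.
Qed.

Lemma least_squares_rate (gstar : R) :
  (forall v, set_dist T v < 2 * beta -> gstar <= norm2 (F v) ^+ 2) ->
  (forall v, T v -> norm2 (F v) ^+ 2 = gstar) ->
  (forall v, set_dist T v < beta ->
    exists t, [/\ T t, norm2 (t - v) = set_dist T v &
      forall s : R, 0 <= s <= 1 ->
        norm2 (Hs (t - v) (t - v) (v + s *: (t - v))) * norm2 (F (v + s *: (t - v)))
          <= norm2 (J (t - v) (v + s *: (t - v))) ^+ 2]) ->
  exists2 tau0 : R, 0 < tau0 &
    forall tau, 0 < tau <= tau0 -> forall v, set_dist T v < beta ->
      (forall n, set_dist T (grad_descent g tau v n) < beta) /\
      exists K : R, forall n, (0 < n)%N ->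
        g (grad_descent g tau v n) - gstar <= K / n%:R.
Proof.
move=> g_min g_T conv.
have [t0 Tt0] := T_nonempty.
pose N := M1 + 2 * beta * M2.
have N_ge0 : 0 <= N by rewrite addr_ge0// !mulr_ge0// ltW.
have B_ge0 : 0 <= B.
  have : set_dist T t0 < 2 * beta.
    apply: (le_lt_trans (set_dist_le _ Tt0)).
    by rewrite subrr norm20 mulr_gt0.
  by move=> /F_bound; apply: le_trans; exact: norm2_ge0.
(* Both constants come from Cauchy-Schwarz on [g1] and [g2]; the added 1 makes them positive even if
   the bounds vanish. *)
apply: (@grad_descent_rate _ _ g g1 g2 _ sqr_norm2_derive sqr_norm2_derive2
  T beta (2 * N * B + 1) (2 * (N ^+ 2 + M2 * B) + 1) gstar) => //.
- by move=> v a u w; rewrite /g1 J_lin dotrDl dotrZl; ring.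
- by rewrite ltr_pwDr// !mulr_ge0.
- by rewrite ltr_pwDr// mulr_ge0// addr_ge0 ?sqr_ge0 ?mulr_ge0.
- move=> u v vb; rewrite mulrDl mul1r.
  have : dotr (J u v) (F v) <= N * norm2 u * B.
    apply: (le_trans (dotr_le _ _)).
    by rewrite ler_pM ?norm2_ge0 ?norm2_jacobian_le ?F_bound.
  by rewrite /g1; have := norm2_ge0 u; lra.
- move=> u v vb; rewrite mulrDl mul1r.
  have : dotr (Hs u u v) (F v) <= M2 * norm2 u * norm2 u * B.
    apply: (le_trans (dotr_le _ _)).
    by rewrite ler_pM ?norm2_ge0 ?norm2_second_derivative_le ?F_bound.
  have : norm2 (J u v) ^+ 2 <= (N * norm2 u) ^+ 2.
    by rewrite ler_sqr ?nnegrE ?mulr_ge0 ?norm2_ge0 ?norm2_jacobian_le.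
  by rewrite /g2; have := sqr_ge0 (norm2 u); lra.
move=> v vb; have [t [Tt tv convt]] := conv v vb; exists t; split=> // s s01.
have := convt s s01; rewrite /g2; set z := v + _.
have := normr_dotr_le (Hs (t - v) (t - v) z) (F z).
by rewrite ler_norml => /andP[+ _]; lra.
Qed.

End LeastSquares.

(** * Weak-* derivatives of linear measurements *)

Section RealCoordinates.
Context {R : realType}.

(** Isometric identification of complex [m]-space with real [2m]-space, where [dotr] is the real
    part of the Hermitian product. *)
Definition real_coord m (z : 'rV[R[i]]_m) : 'rV[R]_(m + m) :=
  row_mx (map_mx (@complex.Re R) z) (map_mx (@complex.Im R) z).

Lemma real_coordD m (z w : 'rV[R[i]]_m) :
  real_coord (z + w) = real_coord z + real_coord w.
Proof.
by rewrite /real_coord add_row_mx; congr row_mx; apply/rowP => j; rewrite !mxE raddfD.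
Qed.

Lemma real_coordZ m (a : R) (z : 'rV[R[i]]_m) :
  real_coord (a%:C *: z) = a *: real_coord z.
Proof.
rewrite /real_coord scale_row_mx; congr row_mx; apply/rowP => j; rewrite !mxE.
  by case: (z _ _) => x y /=; ring.
by case: (z _ _) => x y /=; ring.
Qed.

Lemma real_coordN m (z : 'rV[R[i]]_m) : real_coord (- z) = - real_coord z.
Proof.
by rewrite /real_coord opp_row_mx; congr row_mx; apply/rowP => j; rewrite !mxE raddfN.
Qed.

Lemma normC2E m (z : 'rV[R[i]]_m) : normC2 z = norm2 (real_coord z).
Proof.
rewrite /normC2 /norm2 big_split_ord /= -big_split /=; congr Num.sqrt.
apply: eq_bigr => j _; rewrite row_mxEl row_mxEr !mxE.
by case: (z _ _) => x y /=; rewrite sqr_sqrtr// addr_ge0 ?sqr_ge0.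
Qed.

Lemma cvg_Re_Im (T : Type) (F : set_system T) (FF : Filter F) (f : T -> R[i]^o) (z : R[i]^o) :
  f x @[x --> F] --> z ->
  (complex.Re (f x) @[x --> F] --> complex.Re z) /\
  (complex.Im (f x) @[x --> F] --> complex.Im z).
Proof.
move=> /cvgrPdist_lt fz.
(* The norm of [R[i]] is itself complex-valued: the radius is embedded and the inequality brought
   back to [R]. *)
have fz' (eps : R) : 0 < eps ->
    \forall x \near F, Normc.normc (z - f x) < eps.
  move=> eps0; have := fz eps%:C; rewrite ltcR => /(_ eps0).
  by apply: filterS => x; rewrite [`|_|]/(_%:C) ltcR.
split; apply/cvgrPdist_lt => eps eps0; have := fz' _ eps0; apply: filterS => x;
  apply: le_lt_trans; rewrite -raddfB.
  by have := normc_ge_Re (z - f x); rewrite lecR.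
case: (z - f x) => a b /=.
by rewrite -[leLHS]sqrtr_sqr ler_wsqrtr// lerDr sqr_ge0.
Qed.

End RealCoordinates.

Section Measurements.
Context {R : realType} {D : completeNormedModType R[i]} {m : nat}.
Variables (A : {linear dual D -> 'rV[R[i]]_m}) (alpha : 'I_m -> D).
Hypothesis A_form : forall (x : dual D) (l : 'I_m), A x ord0 l = x (alpha l).

(** Each coordinate of [A] is evaluation at some [alpha l], and weak-* convergence is pointwise
    convergence. *)
Lemma cvg_measurement (T : Type) (F : set_system T) (FF : Filter F)
    (f : T -> dual D) (x : dual D) i :
  f t @[t --> F] --> x ->
  real_coord (A (f t)) ord0 i @[t --> F] --> real_coord (A x) ord0 i.
Proof.
move=> fx; have coord l : (f t (alpha l) : R[i]^o) @[t --> F] --> x (alpha l).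
  exact: (iffLR (weak_star_cvgP x (fmap_filter _ FF)) fx (alpha l)).
case: (split_ordP i) => l ->; have [fRe fIm] := cvg_Re_Im FF (coord l).
  rewrite row_mxEl mxE A_form; under eq_fun do rewrite row_mxEl mxE A_form.
  exact: fRe.
rewrite row_mxEr mxE A_form; under eq_fun do rewrite row_mxEr mxE A_form.
exact: fIm.
Qed.

Context {d : nat}.
Implicit Types (psi : 'rV[R]_d -> dual D) (u v w : 'rV[R]_d).

(** [wpartial] is defined by [lim]; the Hausdorff property identifies it with the actual limit. *)
Lemma wpartial_cvg psi u v : weak_star_gateaux psi v ->
  diff_quot psi u v h @[h --> 0^'] --> wpartial u psi v.
Proof.
move=> [L [_ /(_ u) Lu]]; rewrite /wpartial.
by have -> := cvg_lim (@weak_star_hausdorff _ D) Lu.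
Qed.

Lemma wpartial_linear psi v (a : R) u w : weak_star_gateaux psi v ->
  wpartial (a *: u + w) psi v = a%:C *: wpartial u psi v + wpartial w psi v.
Proof.
move=> [L [Llin Lu]]; rewrite /wpartial.
by rewrite !(cvg_lim (@weak_star_hausdorff _ D) (Lu _)).
Qed.

Lemma real_coord_diff_quot psi u v h :
  real_coord (A (diff_quot psi u v h)) =
    h^-1 *: (real_coord (A (psi (v + h *: u))) - real_coord (A (psi v))).
Proof. by rewrite /diff_quot linearZ linearB real_coordZ real_coordD real_coordN. Qed.

(** Used with [psi] equal to [phi] and to [wpartial u phi], it gives both derivatives of the
    residual. *)
Lemma measurement_derive psi u v i (s : R) : (forall v, weak_star_gateaux psi v) ->
  is_derive s 1 (fun s : R => real_coord (A (psi (v + s *: u))) ord0 i)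
    (real_coord (A (wpartial u psi (v + s *: u))) ord0 i).
Proof.
move=> gat; have := cvg_measurement (i := i) _ (wpartial_cvg (u := u) (gat (v + s *: u))).
have -> : (fun h => real_coord (A (diff_quot psi u (v + s *: u) h)) ord0 i) =
  (fun h => h^-1 *: (((fun s : R => real_coord (A (psi (v + s *: u))) ord0 i) \o
      shift s) (h *: 1) - real_coord (A (psi (v + s *: u))) ord0 i)).
  apply/funext => h; rewrite real_coord_diff_quot /= [_%:A]mulr1 scalerDl addrCA.
  by rewrite (addrC (h *: u)) mxE [X in _ * X]mxE [X in _ + X]mxE.
move=> /(_ _) lim_h; apply: DeriveDef; first by apply/cvg_ex; eexists; exact: lim_h.
exact: cvg_lim lim_h.
Qed.

End Measurements.

(** * Restricted isometry on secants and tangents *)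

Lemma ereal_sup_lt_pinfty_bound (R : realType) (S : set (\bar R)) :
  (ereal_sup S < +oo)%E ->
  exists2 M : R, 0 <= M & forall r : R, S r%:E -> r <= M.
Proof.
move=> S_fin; exists (Num.max 0 (fine (ereal_sup S))); first by rewrite le_max lexx.
move=> r Sr; have := ereal_sup_ubound Sr; move: S_fin.
case: (ereal_sup S) => [M _|//|//]; rewrite lee_fin => rM.
by rewrite le_max rM orbT.
Qed.

Section RestrictedIsometry.
Context {R : realType} {D : completeNormedModType R[i]} {H : completeNormedModType R}.
Context {m : nat} {Sigma : set (dual D)} {iota : dual D -> H}.
Context {A : {linear dual D -> 'rV[R[i]]_m}} {gamma : R}.
Hypotheses (Sigma_H : included_in_hilbert Sigma iota)
  (A_RIP : has_RIP A iota (secant_set Sigma) gamma)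
  (gamma_bounds : 0 <= gamma < 1).

Lemma iota_scaled_secant x y (c : R) : Sigma x -> Sigma y ->
  iota (c%:C *: (x - y)) = c *: iota (x - y).
Proof.
move=> Sx Sy; have [_ comb] := Sigma_H.
have iotaE (a : R) : iota (a%:C *: (x - y)) = a *: (iota x - iota y).
  by rewrite scalerBr -scaleNr -raddfN comb// scaleNr scalerBr.
by rewrite iotaE; have := iotaE 1; rewrite !scale1r => ->.
Qed.

(** Both sides scale by [c^2]; the factor [c] makes the bound apply to difference quotients of
    [phi]. *)
Lemma RIP_lower x y (c : R) : Sigma x -> Sigma y ->
  (1 - gamma) * `|iota (c%:C *: (x - y))| ^+ 2 <=
    norm2 (real_coord (A (c%:C *: (x - y)))) ^+ 2.
Proof.
move=> Sx Sy; rewrite iota_scaled_secant// linearZ real_coordZ normrZ norm2Z.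
rewrite !exprMn mulrCA ler_wpM2l ?sqr_ge0// -normC2E.
by have [] : _ /\ _ := A_RIP (ex_intro2 _ _ x Sx (ex_intro2 _ _ y Sy erefl)).
Qed.

Lemma RIP_upper x y : Sigma x -> Sigma y ->
  norm2 (real_coord (A (x - y))) <= Num.sqrt (1 + gamma) * `|iota (x - y)|.
Proof.
move=> Sx Sy; have /andP[gamma0 _] := gamma_bounds.
have g0 : 0 <= 1 + gamma by rewrite addr_ge0.
rewrite -ler_sqr ?nnegrE ?norm2_ge0 ?mulr_ge0 ?sqrtr_ge0//.
rewrite -normC2E exprMn [_ (1 + gamma) ^+ 2]sqr_sqrtr//.
by have [] : _ /\ _ := A_RIP (ex_intro2 _ _ x Sx (ex_intro2 _ _ y Sy erefl)).
Qed.

Context {d : nat} {alpha : 'I_m -> D}.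
Hypothesis A_form : forall (x : dual D) (l : 'I_m), A x ord0 l = x (alpha l).

(** Pass to the limit in [RIP_lower] for difference quotients with steps [1/(n+1)]: compatibility
    gives the limit of the Hilbert norms, weak-* convergence that of the measurements. *)
Lemma RIP_tangent (phi : 'rV[R]_d -> dual D) (u v : 'rV[R]_d) :
  compatible_norm Sigma iota phi -> weak_star_gateaux phi v ->
  Sigma (phi v) -> (\forall h \near 0^', Sigma (phi (v + h *: u))) ->
  (1 - gamma) * tangent_norm iota phi u v ^+ 2 <=
    norm2 (real_coord (A (wpartial u phi v))) ^+ 2.
Proof.
move=> compat gat Sv near_S.
have [l0 l0P] := compat v u Sv.
have tan : is_tangent_norm iota phi u v (tangent_norm iota phi u v).
  by apply: (@getPex _ (is_tangent_norm iota phi u v)); exists l0.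
pose h n : R := n.+1%:R^-1.
have h_gt0 n : 0 < h n by rewrite invr_gt0.
have habs : (fun n => `|h n|) = h by apply/funext => n; rewrite gtr0_norm.
have h_cvg : h n @[n --> \oo] --> (0 : R) by exact: cvg_harmonic.
have h_dnbhs : h n @[n --> \oo] --> 0^'.
  move=> U /= /h_cvg; rewrite /nbhs/=; apply: filterS => n; apply.
  exact: lt0r_neq0.
have lhs : (1 - gamma) * `|iota (diff_quot phi u v (h n))| ^+ 2 @[n --> \oo] -->
    (1 - gamma) * tangent_norm iota phi u v ^+ 2.
  have := tan h (fun n => lt0r_neq0 (h_gt0 n)); rewrite habs => /(_ h_cvg) tan_h.
  apply: cvgMl_tmp; rewrite expr2; under eq_fun do rewrite expr2.
  have tan_h' : `|iota (diff_quot phi u v (h n))| @[n --> \oo] -->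
      tangent_norm iota phi u v.
    by move: tan_h; under eq_fun do rewrite (gtr0_norm (h_gt0 _)).
  exact: cvgM.
have rhs : norm2 (real_coord (A (diff_quot phi u v (h n)))) ^+ 2 @[n --> \oo] -->
    norm2 (real_coord (A (wpartial u phi v))) ^+ 2.
  rewrite sqr_norm2; under eq_fun do rewrite sqr_norm2.
  apply: (cvg_big add_continuous) => i _.
  have meas : real_coord (A (diff_quot phi u v (h n))) ord0 i @[n --> \oo] -->
      real_coord (A (wpartial u phi v)) ord0 i.
    apply: (@cvg_measurement _ _ _ _ _ A_form _ _ _ (fun n => diff_quot phi u v (h n))).
    exact: (cvg_comp _ _ h_dnbhs (wpartial_cvg (u := u) gat)).
  exact: cvgM.
have near_n : \forall n \near \oo, Sigma (phi (v + h n *: u)).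
  exact: h_dnbhs near_S.
apply: (ler_cvg_to lhs rhs).
by apply: filterS near_n => n Sn; exact: RIP_lower.
Qed.

End RestrictedIsometry.

(** * Application to the measured residual, and recovery of [x0] *)

Theorem corollary2p2
  (R : realType) (m d : nat)
  (D : completeNormedModType R[i])
  (H : completeNormedModType R) (ip : {dot H for idfun})
  (H_hilbert : forall x : H, `|x| ^+ 2 = ip x x)
  (Sigma : set (dual D)) (iota : dual D -> H)
  (Sigma_cone : is_cone Sigma)
  (Sigma_H : included_in_hilbert Sigma iota)
  (A : {linear dual D -> 'rV[R[i]]_m}) (alpha : 'I_m -> D)
  (A_continuous : continuous (A : dual D -> 'rV[R[i]^o]_m))
  (A_form : forall (x : dual D) (l : 'I_m), A x ord0 l = x (alpha l))
  (gamma : R) (gamma_bounds : 0 <= gamma < 1)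
  (A_RIP : has_RIP A iota (secant_set Sigma) gamma)
  (phi : 'rV[R]_d -> dual D)
  (phi_param : Sigma `<=` range phi)
  (phi_continuous : continuous phi)
  (phi_gateaux2 : twice_weak_star_gateaux phi)
  (Theta_open : open (phi @^-1` Sigma))
  (norm_compatible : compatible_norm Sigma iota phi)
  (x0 : dual D) (x0_Sigma : Sigma x0)
  (e y : 'rV[R[i]]_m) (y_def : y = A x0 + e)
  (g : 'rV[R]_d -> R)
  (g_def : forall theta, g theta = normC2 (A (phi theta) - y) ^+ 2)
  (thetastar : 'rV[R]_d)
  (thetastar_Theta : (phi @^-1` Sigma) thetastar)
  (thetastar_min : forall theta, (phi @^-1` Sigma) theta ->
     g thetastar <= g theta)
  (beta : R) (beta_gt0 : 0 < beta)
  (C : R) (M1 M2 : \bar R)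
  (tech : technical_assumption Sigma iota A phi thetastar beta C M1 M2)
  (basin_cond : forall theta, basin Sigma phi thetastar beta theta ->
     exists2 ttheta, fiber_proj Sigma phi theta thetastar ttheta &
       forall z, segment theta ttheta z ->
         ((C * beta + (Num.sqrt (1 + gamma))^-1 * normC2 e)%:E <=
           equot
             ((1 - gamma) * tangent_norm iota phi (ttheta - theta) z ^+ 2)
             (Num.sqrt (1 + gamma) *
                normC2 (A (wpartial (ttheta - theta)
                             (wpartial (ttheta - theta) phi) z))))%E) :
  exists2 tau0 : R, 0 < tau0 &
    forall tau : R, 0 < tau <= tau0 ->
    forall theta0, basin Sigma phi thetastar beta theta0 ->
      (forall n, Sigma (phi (grad_descent g tau theta0 n))) /\
      exists K : R, forall n : nat, (0 < n)%N ->
        `|iota (phi (grad_descent g tau theta0 n) - x0)| ^+ 2 <=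
          4 / (1 - gamma) * normC2 e ^+ 2 + K / n%:R.
Proof.
have [near_Sigma C_gt0 phi_lip M1E M1_fin M2E M2_fin] := tech.
have [gat gat2] := phi_gateaux2.
have /andP[gamma0 gamma1] := gamma_bounds.
pose T := fiber Sigma phi thetastar.
pose F v := real_coord (A (phi v)) - real_coord y.
have FE v : F v = real_coord (A (phi v) - y) by rewrite real_coordD real_coordN.
have gE : g = fun v => norm2 (F v) ^+ 2.
  by apply/funext => v; rewrite g_def normC2E FE.
have near v : set_dist T v < 2 * beta -> Sigma (phi v) by exact: near_Sigma.
have T0 : T !=set0 by exists thetastar.
have e_ge0 : 0 <= normC2 e by exact: sqrtr_ge0.
(* [x0] is some [phi w], whose residual is [-e], and [thetastar] does at least as well. *)
have gstar_le : norm2 (F thetastar) <= normC2 e.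
  have [w _ phiw] := phi_param _ x0_Sigma.
  have := thetastar_min w; rewrite /= phiw => /(_ x0_Sigma).
  rewrite gE /= ler_sqr ?nnegrE ?norm2_ge0// => /le_trans; apply.
  by rewrite FE phiw y_def opprD addNKr real_coordN norm2N normC2E.
have sg_gt0 : 0 < Num.sqrt (1 + gamma) by rewrite sqrtr_gt0; lra.
(* At distance [beta] this bound is [sqrt (1 + gamma)] times the threshold in [basin_cond]. *)
have F_le v : set_dist T v < 2 * beta ->
    norm2 (F v) <= Num.sqrt (1 + gamma) * (C * set_dist T v) + normC2 e.
  move=> vb; have Sv := near _ vb.
  have -> : F v = real_coord (A (phi v - phi thetastar)) + F thetastar.
    by rewrite /F linearB real_coordD real_coordN addrA subrK.
  apply: (le_trans (ler_norm2D _ _)); apply: lerD => //.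
  apply: (le_trans (RIP_upper A_RIP gamma_bounds Sv thetastar_Theta)).
  by rewrite ler_pM2l//; exact: phi_lip.
have [M1r M1_ge0 M1P] :=
  ereal_sup_lt_pinfty_bound (eq_ind _ (fun x => (x < +oo)%E) M1_fin _ M1E).
have [M2r M2_ge0 M2P] :=
  ereal_sup_lt_pinfty_bound (eq_ind _ (fun x => (x < +oo)%E) M2_fin _ M2E).
have [| | | | | | | | | |tau0 tau0_gt0 rate] := @least_squares_rate R d (m + m) F
  (fun u v => real_coord (A (wpartial u phi v)))
  (fun w u v => real_coord (A (wpartial w (wpartial u phi) v)))
  _ _ _ _ T beta M1r M2r (Num.sqrt (1 + gamma) * (C * (2 * beta)) + normC2 e)
  T0 beta_gt0 M1_ge0 M2_ge0 _ _ _ (norm2 (F thetastar) ^+ 2).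
- move=> v a u w; rewrite (wpartial_linear _ _ _ (gat v)).
  by rewrite linearD linearZ real_coordD real_coordZ.
- move=> u v i s.
  have -> : (fun s : R => F (v + s *: u) ord0 i) =
      (fun s => real_coord (A (phi (v + s *: u))) ord0 i) - cst (real_coord y ord0 i).
    by apply/funext => r; rewrite /F mxE [X in _ + X = _]mxE.
  rewrite -[X in is_derive _ _ _ X]subr0; apply: is_deriveB.
  exact: (measurement_derive A_form).
- by move=> w u v i s; exact: (measurement_derive A_form).
- move=> v u a w w'; rewrite (wpartial_linear _ _ _ (gat2 u v)).
  by rewrite linearD linearZ real_coordD real_coordZ.
- move=> v u [_ phiv] u1; rewrite -normC2E; apply: M1P; exists v, u.
  by [].
- move=> v u w vb u1 w1; rewrite -normC2E; apply: M2P; exists v, u, w.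
  by split=> //; split=> //; exact: near.
- move=> v vb; apply: (le_trans (F_le v vb)); rewrite lerD2r ler_pM2l// ler_pM2l//.
  exact: ltW.
- by move=> v vb; have := thetastar_min v (near v vb); rewrite gE.
- by move=> v [_ phiv]; rewrite /F phiv.
- move=> v vb; have vb2 : set_dist T v < 2 * beta by lra.
  have [t [Tt tv] conv] := basin_cond v (conj (near v vb2) vb).
  exists t; split=> // s /andP[s0 s1]; set z := v + _.
  have zseg : segment v t z.
    exists s; first by rewrite /= in_itv /= s0 s1.
    by rewrite /z scalerBl scale1r scalerBr addrA addrAC.
  (* Moving towards the projection [t] cannot leave the basin. *)
  have zb : set_dist T z < beta.
    apply: le_lt_trans vb; rewrite -[leRHS]tv; apply: (le_trans (set_dist_le _ Tt)).
    have -> : t - z = (1 - s) *: (t - v).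
      by rewrite /z opprD addrA scalerBl scale1r.
    by rewrite norm2Z ger0_norm ?subr_ge0// ler_piMl ?norm2_ge0// gerBl.
  have zb2 : set_dist T z < 2 * beta by lra.
  have near_z : \forall h \near 0^', Sigma (phi (z + h *: (t - v))).
    (* The distance is 1-Lipschitz; the added 1 avoids a zero denominator when [t = v]. *)
    pose r := (2 * beta - set_dist T z) / (norm2 (t - v) + 1).
    have n1 : 0 < norm2 (t - v) + 1 by rewrite ltr_wpDl// norm2_ge0.
    have r0 : 0 < r by rewrite divr_gt0// subr_gt0.
    apply: nbhs_dnbhs; apply/nbhs_normP; exists r => //= h.
    rewrite /ball_ /= sub0r normrN => hr; apply: near.
    apply: le_lt_trans (set_distD _ _ T0) _; rewrite norm2Z -ltrBrDl.
    apply: le_lt_trans (_ : `|h| * (norm2 (t - v) + 1) < _).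
      by rewrite ler_wpM2l// lerDl.
    by rewrite -ltr_pdivlMr.
  have := RIP_tangent Sigma_H A_RIP A_form norm_compatible (gat z) (near z zb2) near_z.
  have := conv z zseg; rewrite (normC2E (A _)) /equot.
  set X := tangent_norm _ _ _ _.
  set W := norm2 (real_coord (A (wpartial _ (wpartial _ _) _))).
  set N := norm2 (real_coord (A (wpartial _ phi _))).
  have W_ge0 : 0 <= W by exact: norm2_ge0.
  have Fz := F_le z zb2.
  (* If the quotient has the value [+oo], the second derivative vanishes and the inequality is
     trivial. *)
  case: eqP => [/eqP|/eqP Wn0].
    rewrite mulf_eq0 gt_eqF//= => /eqP -> _ _.
    by rewrite mul0r sqr_ge0.
  have W_gt0 : 0 < Num.sqrt (1 + gamma) * W by rewrite lt_neqAle eq_sym Wn0 mulr_ge0// ltW.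
  (* The chain is [W |F z| <= W sqrt (1 + gamma) (C beta + |e| / sqrt (1 + gamma)) <= (1 - gamma)
     X^2 <= N^2]. *)
  rewrite lee_fin ler_pdivlMr// => WX XN; apply: le_trans XN; apply: le_trans WX.
  have -> : (C * beta + (Num.sqrt (1 + gamma))^-1 * normC2 e) * (Num.sqrt (1 + gamma) * W) =
      W * (Num.sqrt (1 + gamma) * (C * beta) + normC2 e).
    by field; rewrite lt0r_neq0.
  rewrite ler_wpM2l//; apply: (le_trans Fz); rewrite lerD2r ler_pM2l// ler_pM2l//.
  exact: ltW.
exists tau0 => // tau tau_le v [_ vb].
have [xb [K rateK]] := rate tau tau_le v vb.
rewrite gE; set x := grad_descent _ _ _ in xb rateK *.
have Sx n : Sigma (phi (x n)).
  apply: near; have := xb n; lra.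
split=> //; exists (2 * K / (1 - gamma)) => n n0.
have := RIP_lower Sigma_H A_RIP 1 (Sx n) x0_Sigma.
rewrite !scale1r => rip.
(* The vector is [F (x n) + e]. From [|a + b|^2 <= 2 |a|^2 + 2 |b|^2] and
   [|F (x n)|^2 <= |e|^2 + K / n] come the factor 4 and the doubled [K]. *)
have gap : norm2 (real_coord (A (phi (x n) - x0))) ^+ 2 <= 4 * normC2 e ^+ 2 + 2 * (K / n%:R).
  have -> : real_coord (A (phi (x n) - x0)) = F (x n) + real_coord e.
    by rewrite FE -real_coordD y_def linearB opprD addrA subrK.
  have Fs : norm2 (F thetastar) ^+ 2 <= normC2 e ^+ 2.
    by rewrite ler_sqr ?nnegrE ?norm2_ge0.
  have /= Fx := rateK n n0.
  have e2 : norm2 (real_coord e) = normC2 e by rewrite normC2E.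
  have := sqr_ge0 (norm2 (F (x n) - real_coord e)).
  rewrite -scaleN1r !(sqr_norm2D (F (x n))) dotrZr norm2Z normrN1 mul1r e2; lra.
have g1 : 0 < 1 - gamma by lra.
have -> : 4 / (1 - gamma) * normC2 e ^+ 2 + 2 * K / (1 - gamma) / n%:R =
    (4 * normC2 e ^+ 2 + 2 * (K / n%:R)) / (1 - gamma).
  by field; rewrite lt0r_neq0// pnatr_eq0 -lt0n.
by rewrite ler_pdivlMr// mulrC; exact: le_trans rip gap.
Qed.
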